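(* Let $G$ be an abelian group and $\phi\in\mathcal{P}^{\mathbb{H}}_*(G)$. If $\mu$ is the unique nonnegative Radon measure on $G^\delta$ with $\phi(g)=\int_{G^\delta}\gamma(g)\,d\mu(\gamma)$ for all $g\in G$, then the restrictions of $\mu^{\hat *}$ and $\mu$ to $G^\delta\setminus G^\delta_{\mathbb{R}}$ are mutually singular.
   Context: $\mathbb{H}$ is the real quaternion algebra, $\mathbb{S}=\{q\in\mathbb{H}:|q|=1\}$. For an abelian group $G$, $\phi:G\to\mathbb{H}$ is positive definite if for all $k$, $g_i\in G$, $q_i\in\mathbb{H}$, $\sum_{i,j=1}^k\overline{q_i}\,\phi(g_j-g_i)\,q_j$ is a nonnegative real number; $\mathcal{P}^{\mathbb{H}}_*(G)$ is the set of such $\phi$ with $\phi(0)=1$. $G^\delta=\mathrm{Hom}(G,\mathbb{S})$ with the topology of pointwise convergence; $G^\delta_{\mathbb{R}}\subseteq G^\delta$ is the subset of real-valued homomorphisms (i.e. with values in $\{\pm1\}$). The involution on $G^\delta$ is $\gamma\mapsto\gamma^*:=\overline{\gamma}$ (pointwise quaternionic conjugation), a homeomorphism of $G^\delta$; for a Radon measure $\mu$ on $G^\delta$, $\mu^{\hat*}$ is the push-forward, $\mu^{\hat*}(\Omega)=\mu(\Omega^* )$ for Borel $\Omega\subseteq G^\delta$, where $\Omega^*=\{\gamma^*:\gamma\in\Omega\}$. *)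

(* Defs.v *)
From HB Require Import structures.
From mathcomp Require Import all_boot all_order all_algebra.
From mathcomp Require Import all_classical all_reals all_analysis.
From mathcomp Require Import ring.
Set Implicit Arguments. Unset Strict Implicit. Unset Printing Implicit Defensive.
Import Order.TTheory GRing.Theory Num.Theory.
Local Open Scope classical_set_scope.
Local Open Scope ring_scope.

Record quat (R : realType) := Quat { q0 : R; q1 : R; q2 : R; q3 : R }.
Arguments Quat {R}.

Section Quaternions.
Variable R : realType.

Definition qone : quat R := Quat 1 0 0 0.
Definition qadd (p q : quat R) : quat R :=
  Quat (q0 p + q0 q) (q1 p + q1 q) (q2 p + q2 q) (q3 p + q3 q).
Definition qsub (p q : quat R) : quat R :=
  Quat (q0 p - q0 q) (q1 p - q1 q) (q2 p - q2 q) (q3 p - q3 q).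
(* Hamilton product, i^2 = j^2 = k^2 = ijk = -1 *)
Definition qmul (p q : quat R) : quat R :=
  Quat (q0 p * q0 q - q1 p * q1 q - q2 p * q2 q - q3 p * q3 q)
       (q0 p * q1 q + q1 p * q0 q + q2 p * q3 q - q3 p * q2 q)
       (q0 p * q2 q - q1 p * q3 q + q2 p * q0 q + q3 p * q1 q)
       (q0 p * q3 q + q1 p * q2 q - q2 p * q1 q + q3 p * q0 q).
Definition qconj (q : quat R) : quat R := Quat (q0 q) (- q1 q) (- q2 q) (- q3 q).
Definition qabs (q : quat R) : R :=
  Num.sqrt (q0 q ^+ 2 + q1 q ^+ 2 + q2 q ^+ 2 + q3 q ^+ 2).
Definition qreal (q : quat R) : Prop := q1 q = 0 /\ q2 q = 0 /\ q3 q = 0.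
Definition qnonneg_real (q : quat R) : Prop := qreal q /\ 0 <= q0 q.
Definition qsum (k : nat) (f : 'I_k -> quat R) : quat R :=
  Quat (\sum_(i < k) q0 (f i)) (\sum_(i < k) q1 (f i))
       (\sum_(i < k) q2 (f i)) (\sum_(i < k) q3 (f i)).
End Quaternions.

Section PosDef.
Variables (R : realType) (G : zmodType).

Definition posdefH (phi : G -> quat R) : Prop :=
  forall (k : nat) (g : 'I_k -> G) (q : 'I_k -> quat R),
    qnonneg_real (qsum (fun i : 'I_k => qsum (fun j : 'I_k =>
        qmul (qmul (qconj (q i)) (phi (g j - g i))) (q j)))).

Definition PstarH (phi : G -> quat R) : Prop := posdefH phi /\ phi 0 = qone R.

Definition is_char (f : G -> quat R) : Prop :=
  (forall g, qabs (f g) = 1) /\ (forall g h, f (g + h) = qmul (f g) (f h)).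

Record chars := Char { chfun :> G -> quat R; chfunP : is_char chfun }.

Lemma is_char_one : is_char (fun _ => qone R).
Proof.
split=> [g|g h]; last by rewrite /qmul /qone /=; congr Quat; ring.
by rewrite /qabs /= expr1n !expr0n /= !addr0 sqrtr1.
Qed.

HB.instance Definition _ := gen_eqMixin chars.
HB.instance Definition _ := gen_choiceMixin chars.
HB.instance Definition _ := isPointed.Build chars (Char is_char_one).

(* topology of pointwise convergence on G^delta (subspace of (H)^G):
   U is open iff around each of its points it contains a basic
   neighbourhood { gamma' : |gamma'(g) - gamma(g)| < e for g in s } *)
Definition ptws_open (U : set chars) : Prop :=
  forall gam, U gam -> exists (s : seq G) (e : R), 0 < e /\
    forall gam' : chars, (forall g, g \in s -> qabs (qsub (gam' g) (gam g)) < e) ->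
      U gam'.

Definition open_sets : set (set chars) := [set U | ptws_open U].

Definition ptws_compact (K : set chars) : Prop :=
  forall (I : Type) (U : I -> set chars), (forall i, ptws_open (U i)) ->
    K `<=` [set x | exists i, U i x] ->
    exists (n : nat) (f : 'I_n -> I), K `<=` [set x | exists j : 'I_n, U (f j) x].

Definition Gdelta := g_sigma_algebraType open_sets.

Definition Gdelta_R : set Gdelta := [set gam | forall g, qreal (chfun gam g)].

Definition conjset (Om : set Gdelta) : set Gdelta :=
  [set gam | exists2 gam', Om gam' & forall g, chfun gam g = qconj (chfun gam' g)].

Definition radon (mu : {measure set Gdelta -> \bar R}) : Prop :=
  [/\ (forall K, ptws_compact K -> (mu K < +oo)%E),
      (forall A, measurable A ->
         mu A = ereal_inf [set mu U | U in [set U | ptws_open U /\ A `<=` U]]) &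
      (forall U, ptws_open U ->
         mu U = ereal_sup [set mu K | K in [set K | ptws_compact K /\ K `<=` U]])].

Definition represents (mu : {measure set Gdelta -> \bar R}) (phi : G -> quat R)
  : Prop :=
  forall g,
    [/\ mu.-integrable setT (fun gam : Gdelta => (q0 (chfun gam g))%:E),
        mu.-integrable setT (fun gam : Gdelta => (q1 (chfun gam g))%:E),
        mu.-integrable setT (fun gam : Gdelta => (q2 (chfun gam g))%:E),
        mu.-integrable setT (fun gam : Gdelta => (q3 (chfun gam g))%:E) &
        phi g = Quat (Rintegral mu setT (fun gam : Gdelta => q0 (chfun gam g)))
                     (Rintegral mu setT (fun gam : Gdelta => q1 (chfun gam g)))
                     (Rintegral mu setT (fun gam : Gdelta => q2 (chfun gam g)))
                     (Rintegral mu setT (fun gam : Gdelta => q3 (chfun gam g)))].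

Definition pushconj (nu : set Gdelta -> \bar R) : set Gdelta -> \bar R :=
  fun E => nu (conjset E).
Definition restr (nu : set Gdelta -> \bar R) (A : set Gdelta) : set Gdelta -> \bar R :=
  fun E => nu (E `&` A).
Definition mutually_singular (nu1 nu2 : set Gdelta -> \bar R) : Prop :=
  exists B : set Gdelta, [/\ measurable B, nu1 B = 0%E & nu2 (~` B) = 0%E].

End PosDef.

(* Main.v *)
Require Import Defs.
From HB Require Import structures.
From mathcomp Require Import all_boot all_order all_algebra.
From mathcomp Require Import all_classical all_reals all_analysis.
From mathcomp Require Import measurable_realfun ring lra.
Set Implicit Arguments. Unset Strict Implicit. Unset Printing Implicit Defensive.
Import Order.TTheory GRing.Theory Num.Theory.
Import numFieldNormedType.Exports.
Local Open Scope classical_set_scope.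
Local Open Scope ring_scope.

(** Let [mu*] be the push-forward of [mu] under conjugation and [nu] the infimum
    of [mu] and [mu*], obtained from a Hahn decomposition of [mu - mu*].
    Off the real characters [nu] vanishes: by inner regularity and compactness
    it is enough to see that [nu] is null on the set of characters [x] with
    [x g] non-real, for each [g].  The values of such an [x] lie in the complex
    plane spanned by [1] and [x g]; for an imaginary unit [w], rotating this
    plane onto the one spanned by [1] and [w] is continuous in [x] and preserves
    real parts.  Integrals of characters against a conjugation-invariant measure
    only involve real parts, so in [mu] the symmetrization of half of [nu] may be
    replaced by its symmetrized image in the plane of [w].  By uniqueness of [mu]
    this changes nothing, for [w = i] and for [w = j], and the two images have
    disjoint supports. *)

(** * Commuting quaternions and rotation of complex planes *)

Section Quaternions.
Variable R : realType.
Implicit Types p q a b w : quat R.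

Definition qnorm2 q : R := q0 q ^+ 2 + q1 q ^+ 2 + q2 q ^+ 2 + q3 q ^+ 2.

Definition imdot p q : R := q1 p * q1 q + q2 p * q2 q + q3 p * q3 q.

Lemma qnorm2_ge0 q : 0 <= qnorm2 q.
Proof. by rewrite /qnorm2 !addr_ge0 ?sqr_ge0. Qed.

Lemma qabs_eq1 q : qabs q = 1 <-> qnorm2 q = 1.
Proof.
rewrite /qabs -/(qnorm2 q); split=> [h|->]; last by rewrite sqrtr1.
by rewrite -(sqr_sqrtr (qnorm2_ge0 q)) h expr1n.
Qed.

Lemma coord_le_qabs q :
  [/\ `|q0 q| <= qabs q, `|q1 q| <= qabs q, `|q2 q| <= qabs q &
      `|q3 q| <= qabs q].
Proof.
rewrite /qabs; split; rewrite -sqrtr_sqr ler_sqrt;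
  do ?[by rewrite !addr_ge0 ?sqr_ge0];
  have := sqr_ge0 (q0 q); have := sqr_ge0 (q1 q);
  have := sqr_ge0 (q2 q); have := sqr_ge0 (q3 q); lra.
Qed.

Lemma imdot_ge0 q : 0 <= imdot q q.
Proof. by rewrite /imdot !addr_ge0 // -expr2 sqr_ge0. Qed.

Lemma imdot_eq0 q : imdot q q = 0 <-> qreal q.
Proof.
rewrite /imdot /qreal; split=> [|[-> [-> ->]]]; last by rewrite !mulr0 !addr0.
move=> h; have h1 := sqr_ge0 (q1 q); have h2 := sqr_ge0 (q2 q).
have h3 := sqr_ge0 (q3 q); rewrite !expr2 in h1 h2 h3.
by split; [|split]; apply/eqP; rewrite -sqrf_eq0 expr2; apply/eqP; lra.
Qed.

Lemma qabs_near T (F : set_system T) {FF : Filter F} (f : T -> quat R) a :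
  q0 (f t) @[t --> F] --> q0 a -> q1 (f t) @[t --> F] --> q1 a ->
  q2 (f t) @[t --> F] --> q2 a -> q3 (f t) @[t --> F] --> q3 a ->
  forall e, 0 < e -> \forall t \near F, qabs (qsub (f t) a) < e.
Proof.
move=> c0 c1 c2 c3 e e0.
(* Four coordinates within [e / 2] give a distance below [e]. *)
have e2 : 0 < e / 2 by rewrite divr_gt0.
near=> t.
have h0 : `|q0 a - q0 (f t)| < e / 2 by near: t; exact: cvgr_dist_lt.
have h1 : `|q1 a - q1 (f t)| < e / 2 by near: t; exact: cvgr_dist_lt.
have h2 : `|q2 a - q2 (f t)| < e / 2 by near: t; exact: cvgr_dist_lt.
have h3 : `|q3 a - q3 (f t)| < e / 2 by near: t; exact: cvgr_dist_lt.
have sq (u v : R) : `|u - v| < e / 2 -> (v - u) ^+ 2 < (e / 2) ^+ 2.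
  move=> h; rewrite -(real_normK (num_real (v - u))) distrC.
  by rewrite ltr_pXn2r ?nnegrE// ltW.
rewrite /qabs -[ltRHS]gtr0_norm// -sqrtr_sqr ltr_sqrt ?exprn_gt0//=.
have := sq _ _ h0; have := sq _ _ h1; have := sq _ _ h2; have := sq _ _ h3.
rewrite expr_div_n; lra.
Unshelve. all: by end_near. Qed.

(* For [a] commuting with [p], this is the image of [a] under the isomorphism
   from the complex plane through [p] onto the one through [w]. *)
Definition qalign w p a : quat R :=
  let s := imdot p a / Num.sqrt (imdot p p) in
  Quat (q0 a) (s * q1 w) (s * q2 w) (s * q3 w).

(** The cross product of the imaginary parts vanishes, i.e. they are parallel. *)
Definition qcross0 p a :=
  [/\ q2 p * q3 a = q3 p * q2 a, q3 p * q1 a = q1 p * q3 a &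
      q1 p * q2 a = q2 p * q1 a].

Lemma qmul_comm_cross0 p a : qmul p a = qmul a p -> qcross0 p a.
Proof. by case: p => ? ? ? ?; case: a => ? ? ? ? [] /= *; split => /=; lra. Qed.

(** By the Binet-Cauchy identity the two sides differ by the scalar product of the cross products of
    [p] with [a] and of [p] with [b]. *)
Lemma imdot_cross0 p a b : qcross0 p a -> qcross0 p b ->
  imdot p p * imdot a b = imdot p a * imdot p b.
Proof.
move=> [h1 h2 h3] [k1 k2 k3].
have -> : imdot p p * imdot a b = imdot p a * imdot p b +
    (q2 p * q3 a - q3 p * q2 a) * (q2 p * q3 b - q3 p * q2 b) +
    (q3 p * q1 a - q1 p * q3 a) * (q3 p * q1 b - q1 p * q3 b) +
    (q1 p * q2 a - q2 p * q1 a) * (q1 p * q2 b - q2 p * q1 b).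
  by rewrite /imdot; ring.
by rewrite h1 h2 h3 k1 k2 k3 !subrr !mulr0 !addr0.
Qed.

(** The coefficient [s] along [w] squares to [imdot a a], by the equality case of Cauchy-Schwarz for
    parallel vectors. *)
Lemma qalign_norm2 w p a : imdot w w = 1 -> 0 < imdot p p -> qcross0 p a ->
  qnorm2 (qalign w p a) = qnorm2 a.
Proof.
move=> w1 p0 pa; rewrite /qnorm2 /qalign /=.
set s := _ / _.
have -> : q0 a ^+ 2 + (s * q1 w) ^+ 2 + (s * q2 w) ^+ 2 + (s * q3 w) ^+ 2 =
   q0 a ^+ 2 + s ^+ 2 * imdot w w by rewrite /imdot; ring.
have -> : s ^+ 2 = imdot a a.
  rewrite /s expr_div_n sqr_sqrtr ?ltW// expr2 -imdot_cross0//.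
  by rewrite mulrC mulKf ?gt_eqF.
by rewrite w1 /imdot; ring.
Qed.

(** Each factor is determined by its real part and its coordinate along the imaginary part of [p],
    and in these two coordinates the product is that of complex numbers. *)
Lemma qalignM w p a b : imdot w w = 1 -> 0 < imdot p p ->
  qcross0 p a -> qcross0 p b ->
  qalign w p (qmul a b) = qmul (qalign w p a) (qalign w p b).
Proof.
move=> w1 p0 pa pb.
set r := Num.sqrt (imdot p p).
have r0 : r != 0 by rewrite gt_eqF// sqrtr_gt0.
have im : imdot p (qmul a b) = q0 a * imdot p b + q0 b * imdot p a.
  (* The last three terms form the triple product of [p], [a] and [b], which vanishes. *)
  have -> : imdot p (qmul a b) = q0 a * imdot p b + q0 b * imdot p a +
      (q2 p * q3 a - q3 p * q2 a) * q1 b + (q3 p * q1 a - q1 p * q3 a) * q2 b +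
      (q1 p * q2 a - q2 p * q1 a) * q3 b by rewrite /imdot /=; ring.
  by case: pa => -> -> ->; rewrite !subrr !mul0r !addr0.
have re : imdot a b = imdot p a / r * (imdot p b / r).
  rewrite mulrACA -imdot_cross0// -invfM -expr2 sqr_sqrtr ?ltW//.
  by rewrite mulrC mulKf ?gt_eqF.
rewrite /qalign im -/r /qmul /=; congr Quat; last 3 first.
- by ring.
- by ring.
- by ring.
have -> : q0 a * q0 b - q1 a * q1 b - q2 a * q2 b - q3 a * q3 b =
  q0 a * q0 b - imdot a b by rewrite /imdot; ring.
rewrite re -[X in q0 a * q0 b - X]mulr1 -w1 {3}/imdot; ring.
Qed.

End Quaternions.

(** * Topology of pointwise convergence on characters *)

Section Topology.
Variables (R : realType) (G : zmodType).
Local Notation X := (chars R G).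
Implicit Types (x y : X) (U V K A : set X) (g h : G).

(** [ptws_open U] unfolds to membership of [U] in this filter at each point of [U], so the calculus
    of limits along filters applies to characters. *)
Definition ptws_nbhs x : set_system X :=
  [set U | exists (s : seq G) (e : R), 0 < e /\
    forall y, (forall g, g \in s -> qabs (qsub (y g) (x g)) < e) -> U y].

#[global] Instance ptws_nbhs_filter x : Filter (ptws_nbhs x).
Proof.
split=> [|P Q [s [e [e0 hP]]] [t [d [d0 hQ]]]|P Q PQ [s [e [e0 hP]]]].
- by exists [::], 1.
- exists (s ++ t), (Num.min e d); split; first by rewrite lt_min e0.
  move=> y hy; split.
    apply: hP => g gs; have := hy g; rewrite mem_cat gs => /(_ isT).
    by rewrite lt_min => /andP[].
  apply: hQ => g gs; have := hy g; rewrite mem_cat gs orbT => /(_ isT).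
  by rewrite lt_min => /andP[].
- by exists s, e; split=> // y /hP /PQ.
Qed.

Lemma char_eqP x y : (forall g, x g = y g) -> x = y.
Proof.
case: x y => [f hf] [f' hf'] /= /funext e; move: hf hf'; rewrite e => hf hf'.
by congr Char; exact: Prop_irrelevance.
Qed.

Lemma char_norm2 x g : qnorm2 (x g) = 1.
Proof. by apply/qabs_eq1; case: (chfunP x). Qed.

(** As an idempotent of norm 1, [x 0] has a real part [a] with [2 a^2 = 1 + a]. The root [-1/2]
    would make the imaginary part vanish, against the norm. *)
Lemma char0 x : q0 (x 0) = 1.
Proof.
have [_ /(_ 0 0)] := chfunP x; rewrite addr0; have := char_norm2 x 0.
case: (x 0) => a b c d; rewrite /qnorm2 /= => n [e0 e1 e2 e3].
have {}e0 : 2 * a ^+ 2 = 1 + a by lra.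
have := sqr_ge0 b; have := sqr_ge0 c; have := sqr_ge0 d => d0 c0 b0.
have /eqP : (a - 1) * (2 * a + 1) = 0.
  have -> : (a - 1) * (2 * a + 1) = 2 * a ^+ 2 - a - 1 by ring.
  by rewrite e0; lra.
rewrite mulf_eq0 => /orP[/eqP|/eqP a1]; first by lra.
exfalso; have {}a1 : a = - (1/2) by lra.
subst a.
have b1 : b = 0 by lra.
have c1 : c = 0 by lra.
have d1 : d = 0 by lra.
by subst b c d; lra.
Qed.

(** Commutativity of [G] makes the values of a character commute with each other. *)
Lemma char_cross0 x g h : qcross0 (x g) (x h).
Proof.
by apply: qmul_comm_cross0; have [_ e] := chfunP x; rewrite -!e addrC.
Qed.

Lemma coord_le1 x g :
  [/\ `|q0 (x g)| <= 1, `|q1 (x g)| <= 1, `|q2 (x g)| <= 1 & `|q3 (x g)| <= 1].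
Proof. by have [e _] := chfunP x; rewrite -(e g); exact: coord_le_qabs. Qed.

Lemma cvg_coord x g :
  [/\ (fun y : X => q0 (y g)) @ ptws_nbhs x --> q0 (x g),
      (fun y : X => q1 (y g)) @ ptws_nbhs x --> q1 (x g),
      (fun y : X => q2 (y g)) @ ptws_nbhs x --> q2 (x g) &
      (fun y : X => q3 (y g)) @ ptws_nbhs x --> q3 (x g)].
Proof.
split; apply/cvgrPdist_lt => e e0; exists [:: g], e; split=> // y /(_ g);
  rewrite mem_head => /(_ isT) /(le_lt_trans _) h; rewrite distrC;
  by apply: h; case: (coord_le_qabs (qsub (y g) (x g))).
Qed.

Lemma ptws_nbhs_cvg (T : Type) (F : set_system T) {FF : Filter F}
    (f : T -> X) x :
  (forall g, [/\ q0 (f t g) @[t --> F] --> q0 (x g),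
      q1 (f t g) @[t --> F] --> q1 (x g), q2 (f t g) @[t --> F] --> q2 (x g) &
      q3 (f t g) @[t --> F] --> q3 (x g)]) ->
  f @ F --> ptws_nbhs x.
Proof.
move=> cf U [s [e [e0 hU]]].
suff : \forall t \near F, forall g, g \in s -> qabs (qsub (f t g) (x g)) < e.
  by apply: filterS => t; exact: hU.
elim: s {hU} => [|g s ih]; first by apply: nearW => t g.
have [c0 c1 c2 c3] := cf g.
apply: filterS2 ih (qabs_near c0 c1 c2 c3 e0) => t ih hg k.
by rewrite inE => /orP[/eqP->//|]; exact: ih.
Qed.

(** Limits are along full neighbourhoods; for open [A] this is continuity of the restriction to
    [A]. *)
Definition ptws_cont_on A (F : X -> X) :=
  forall x, A x -> F @ ptws_nbhs x --> ptws_nbhs (F x).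

Lemma ptws_openT : ptws_open (setT : set X).
Proof. by move=> x _; exact: (@filterT _ (ptws_nbhs x)). Qed.

Lemma ptws_open_bigcup (I : Type) (U : I -> set X) :
  (forall i, ptws_open (U i)) -> ptws_open [set x | exists i, U i x].
Proof.
move=> oU x [i] /oU xU; apply: (@filterS _ (ptws_nbhs x)) xU.
by move=> y ?; exists i.
Qed.

Lemma ptws_open_preimage A (F : X -> X) U : ptws_open A ->
  ptws_cont_on A F -> ptws_open U -> ptws_open (A `&` F @^-1` U).
Proof.
move=> oA cF oU x [Ax /oU FxU].
by apply: (@filterI _ (ptws_nbhs x)); [exact: oA|exact: cF].
Qed.

Lemma ptws_open_real (f : X -> R) (O : set R) :
  (forall x, f @ ptws_nbhs x --> f x) -> open O -> ptws_open (f @^-1` O).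
Proof. by move=> cf oO x xO; apply: (cf x); exact: open_nbhs_nbhs. Qed.

(** Some coordinate of some evaluation serves as [f]; this yields the Hausdorff property. *)
Lemma char_separated x y : x <> y -> exists f : X -> R,
  (forall z, f @ ptws_nbhs z --> f z) /\ f x != f y.
Proof.
move=> xy; apply: contrapT => /forallNP nf; apply: xy; apply: char_eqP => g.
have e (c : quat R -> R) :
    (forall z, (fun t : X => c (t g)) @ ptws_nbhs z --> c (z g)) ->
    c (x g) = c (y g).
  move=> cc; apply/eqP; apply: contrapT => /negP ne.
  by apply: (nf (fun z : X => c (z g))).
have e0 : q0 (x g) = q0 (y g) by apply: e => z; case: (cvg_coord z g).
have e1 : q1 (x g) = q1 (y g) by apply: e => z; case: (cvg_coord z g).
have e2 : q2 (x g) = q2 (y g) by apply: e => z; case: (cvg_coord z g).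
have e3 : q3 (x g) = q3 (y g) by apply: e => z; case: (cvg_coord z g).
case: (x g) (y g) e0 e1 e2 e3 => a b c d [a' b' c' d'] /=.
by move=> -> -> -> ->.
Qed.

Lemma ptws_compact_closed K : ptws_compact K -> ptws_open (~` K).
Proof.
move=> cK x nKx.
(* The cover of [K] is indexed by all pairs of disjoint open sets whose second member contains [x],
   so no pair has to be chosen for each point of [K]. *)
pose Q (VW : set X * set X) := [/\ ptws_open VW.1, ptws_open VW.2,
   VW.1 `&` VW.2 = set0 & VW.2 x].
have [i|y Ky|n [f Kf]] := cK {VW | Q VW} (fun i => (sval i).1).
- by case: (svalP i).
- have yx : y <> x by move=> e; apply: nKx; rewrite -e.
  have [f [cf fxy]] := char_separated yx.
  pose d := `|f y - f x| / 2.
  have d0 : 0 < d by rewrite divr_gt0// normr_gt0 subr_eq0.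
  suff h : Q (f @^-1` ball (f y) d, f @^-1` ball (f x) d).
    by exists (exist Q _ h) => /=; exact: ballxx.
  split=> /=.
  + by apply: ptws_open_real => //; exact: ball_open.
  + by apply: ptws_open_real => //; exact: ball_open.
  + rewrite -subset0 => z [] /=; rewrite -!ball_normE /= => h1 h2.
    have := ler_distD (f z) (f y) (f x); rewrite [`|f z - _|]distrC => h.
    by move: d0 h1 h2; rewrite /d; lra.
  + exact: ballxx.
have : \forall y \near ptws_nbhs x, forall j : 'I_n, (sval (f j)).2 y.
  by apply: filter_forall => j; case: (svalP (f j)) => _ + _; exact.
apply: filterS => y hy /Kf[j] /= Vy.
have [_ _ e _] := svalP (f j).
suff : ((sval (f j)).1 `&` (sval (f j)).2) y by rewrite e.
by split=> //; exact: hy.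
Qed.

Lemma ptws_compactD K U : ptws_compact K -> ptws_open U ->
  ptws_compact (K `\` U).
Proof.
move=> cK oU I V oV KV.
(* An empty difference is treated apart, since [I] may then be empty; otherwise some [i0] in [I] can
   replace the index [None] of [U] in the finite subcover. *)
have [[x [Kx nUx]]|no] := pselect (exists x, (K `\` U) x); last first.
  exists 0%N, (fun j : 'I_0 => False_rect I (notF (ltn_ord j))) => x Kx.
  by case: no; exists x.
have [i0 _] : exists i, V i x by exact: KV.
have [[i|]|y Ky|n [f Kf]] :=
  cK (option I) (fun i => if i is Some j then V j else U).
- exact: oV.
- exact: oU.
- have [Uy|nUy] := pselect (U y); first by exists None.
  by have [i] := KV y (conj Ky nUy); exists (Some i).
exists n, (fun j => odflt i0 (f j)) => y [/Kf [j] /=].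
by case e: (f j) => [i|] Vy nUy //; exists j => /=; rewrite e.
Qed.

Lemma ptws_compactU K K' : ptws_compact K -> ptws_compact K' ->
  ptws_compact (K `|` K').
Proof.
move=> cK cK' I V oV KV.
have [x Kx|n [f Kf]] := cK _ _ oV; first by apply: KV; left.
have [x Kx|m [f' Kf']] := cK' _ _ oV; first by apply: KV; right.
exists (n + m)%N,
  (fun j => match fintype.split j with inl i => f i | inr i => f' i end).
move=> x [/Kf|/Kf'] [j Vj].
- exists (lshift m j) => /=.
  by rewrite -[lshift m j]/(unsplit (inl j)) unsplitK.
- exists (rshift n j) => /=.
  by rewrite -[rshift n j]/(unsplit (inr j)) unsplitK.
Qed.

Lemma ptws_compact_image A K (F : X -> X) : ptws_open A -> ptws_cont_on A F ->
  K `<=` A -> ptws_compact K -> ptws_compact (F @` K).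
Proof.
move=> oA cF KA cK I V oV KV.
have [i|x Kx|n [f Kf]] := cK I (fun i => A `&` F @^-1` (V i)).
- exact: ptws_open_preimage.
- by have [|i Vi] := KV (F x); [exists x|exists i; split => //; exact: KA].
exists n, f => _ [x /Kf[j [_ Vj]] <-]; by exists j.
Qed.

End Topology.

(** * Conjugation and plane rotation as maps of characters *)

Section Maps.
Variables (R : realType) (G : zmodType).
Local Notation X := (chars R G).
Implicit Types (x y : X) (U V K A : set X) (g h : G) (w : quat R).

(** Conjugation reverses products; commutativity of [G] restores the order. *)
Lemma is_char_conj x : is_char (fun g => qconj (x g)).
Proof.
have [n m] := chfunP x; split=> [g|g h].
  by rewrite -(n g) /qabs /=; congr Num.sqrt; ring.
rewrite addrC m; case: (x g) (x h) => ? ? ? ? [? ? ? ?].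
by rewrite /qmul /qconj /=; congr Quat; ring.
Qed.

Definition charconj x : X := Char (is_char_conj x).

Lemma charconjK : involutive charconj.
Proof.
move=> x; apply: char_eqP => g /=; case: (x g) => ? ? ? ?.
by rewrite /qconj /= !opprK.
Qed.

Lemma charconj_cont A : ptws_cont_on A charconj.
Proof.
move=> x _; apply: ptws_nbhs_cvg => g; have [c0 c1 c2 c3] := cvg_coord x g.
by split=> //=; apply: cvgN.
Qed.

Definition nonreal g : set X := [set x | ~ qreal (x g)].

Lemma nonrealP g x : nonreal g x <-> 0 < imdot (x g) (x g).
Proof.
rewrite lt_neqAle imdot_ge0 andbT eq_sym; split=> [h|/eqP h /imdot_eq0//].
by apply/eqP => /imdot_eq0.
Qed.

Lemma cvg_imdot g h x :
  (fun y : X => imdot (y g) (y h)) @ ptws_nbhs x --> imdot (x g) (x h).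
Proof.
have [_ c1 c2 c3] := cvg_coord x g; have [_ d1 d2 d3] := cvg_coord x h.
by apply: cvgD; [apply: cvgD|]; apply: cvgM.
Qed.

Lemma nonreal_open g : ptws_open (nonreal g).
Proof.
have -> : nonreal g = (fun x : X => imdot (x g) (x g)) @^-1` [set r | 0 < r].
  by apply/seteqP; split=> x /nonrealP.
by apply: ptws_open_real; [exact: cvg_imdot|exact: open_gt].
Qed.

Lemma is_char_align w g x : imdot w w = 1 -> nonreal g x ->
  is_char (fun h => qalign w (x g) (x h)).
Proof.
move=> w1 /nonrealP xg; split=> [h|h k].
  apply/qabs_eq1; rewrite qalign_norm2 ?char_norm2//; exact: char_cross0.
have [_ ->] := chfunP x.
by rewrite qalignM//; exact: char_cross0.
Qed.

(** Where [x g] is real there is no plane to rotate; the identity is used there, which keeps the map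
    measurable and real parts unchanged. *)
Definition align w (w1 : imdot w w = 1) g x : X :=
  if pselect (nonreal g x) is left xg then Char (is_char_align w1 xg) else x.

Lemma alignE w (w1 : imdot w w = 1) g x h : nonreal g x ->
  align w1 g x h = qalign w (x g) (x h).
Proof. by rewrite /align; case: pselect. Qed.

Lemma align_real w (w1 : imdot w w = 1) g x : ~ nonreal g x -> align w1 g x = x.
Proof. by rewrite /align; case: pselect. Qed.

Lemma cvg_ext_on (x : X) U (f f' : X -> R) (l : R) : ptws_open U -> U x ->
  (forall y, U y -> f y = f' y) ->
  f' @ ptws_nbhs x --> l -> f @ ptws_nbhs x --> l.
Proof.
move=> oU Ux ff'; apply: cvg_trans; apply: near_eq_cvg.
by apply: (@filterS _ (ptws_nbhs x)) (oU x Ux) => y /ff'.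
Qed.

Lemma align_cont w (w1 : imdot w w = 1) g :
  ptws_cont_on (nonreal g) (align w1 g).
Proof.
move=> x xg; apply: ptws_nbhs_cvg => h.
have s : (fun y : X => imdot (y g) (y h) / Num.sqrt (imdot (y g) (y g)))
    @ ptws_nbhs x --> imdot (x g) (x h) / Num.sqrt (imdot (x g) (x g)).
  apply: cvgM; first exact: cvg_imdot.
  apply: cvgV; first by rewrite gt_eqF// sqrtr_gt0; exact/nonrealP.
  apply: (@continuous_cvg _ _ _ _ _ _ (@Num.sqrt R)).
    exact: sqrt_continuous.
  exact: cvg_imdot.
have [c0 _ _ _] := cvg_coord x h.
rewrite !alignE//; split.
- apply: (cvg_ext_on (f' := fun y : X => q0 (y h)) (@nonreal_open g) xg) => //.
  by move=> y yg; rewrite alignE.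
- apply: (cvg_ext_on (f' := fun y : X => q1 (qalign w (y g) (y h)))
    (@nonreal_open g) xg).
    by move=> y yg; rewrite alignE.
  by apply: cvgMr_tmp.
- apply: (cvg_ext_on (f' := fun y : X => q2 (qalign w (y g) (y h)))
    (@nonreal_open g) xg).
    by move=> y yg; rewrite alignE.
  by apply: cvgMr_tmp.
- apply: (cvg_ext_on (f' := fun y : X => q3 (qalign w (y g) (y h)))
    (@nonreal_open g) xg).
    by move=> y yg; rewrite alignE.
  by apply: cvgMr_tmp.
Qed.

(** The value at [g] reveals [w], which tells the images for different units apart. *)
Lemma align_im w (w1 : imdot w w = 1) g x : nonreal g x ->
  [/\ q1 (align w1 g x g) = Num.sqrt (imdot (x g) (x g)) * q1 w,
      q2 (align w1 g x g) = Num.sqrt (imdot (x g) (x g)) * q2 w &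
      q3 (align w1 g x g) = Num.sqrt (imdot (x g) (x g)) * q3 w].
Proof.
move=> xg; rewrite alignE// /qalign /=.
have p := (nonrealP g x).1 xg.
have -> : imdot (x g) (x g) / Num.sqrt (imdot (x g) (x g)) =
    Num.sqrt (imdot (x g) (x g)).
  have {1}-> : imdot (x g) (x g) = Num.sqrt (imdot (x g) (x g)) ^+ 2.
    by rewrite sqr_sqrtr ?ltW.
  by rewrite expr2 mulfK// gt_eqF// sqrtr_gt0.
by [].
Qed.

End Maps.

(** * Differences and Hahn decomposition of finite measures *)

Section MeasureDifference.
Context (d : measure_display) (T : measurableType d) (R : realType).

Let fin_diff (mu la : {finite_measure set T -> \bar R}) :
  (forall A, measurable A -> la A <= mu A)%E ->
  exists rho : {measure set T -> \bar R},
    forall A, measurable A -> mu A = (rho A + la A)%E.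
Proof.
move=> lamu.
pose nu : {charge set T -> \bar R} :=
  cadd (charge_of_finite_measure mu) (copp (charge_of_finite_measure la)).
(* [measure_of_charge] asks for nonnegativity on every set; [crestr0] provides it by taking the
   value 0 on nonmeasurable sets. *)
have nuE E : measurable E ->
    crestr0 nu (@measurableT _ T) E = (mu E - la E)%E.
  by move=> mE; rewrite /crestr0 mem_set// /crestr setIT.
have pos E : (0 <= crestr0 nu (@measurableT _ T) E)%E.
  have [mE|nE] := pselect (measurable E); last by rewrite /crestr0 memNset.
  by rewrite nuE// sube_ge0 ?lamu// fin_num_measure.
exists (measure_of_charge _ pos) => A mA.
by rewrite [X in _ = (X + _)%E]nuE// subeK// fin_num_measure.
Qed.

(** Restricting to [setT] changes no value and supplies the finite measure structure from which
    charges are built. *)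
Lemma finite_measureP (mu : {measure set T -> \bar R}) : (mu setT < +oo)%E ->
  exists nu : {finite_measure set T -> \bar R}, nu = mu :> (set T -> \bar R).
Proof.
move=> muT; exists (mfrestr measurableT muT).
by apply/funext => A; exact: (congr1 mu (setIT A)).
Qed.

Lemma measure_difference (mu la : {measure set T -> \bar R}) :
  (mu setT < +oo)%E -> (forall A, measurable A -> la A <= mu A)%E ->
  exists rho : {measure set T -> \bar R},
    forall A, measurable A -> mu A = (rho A + la A)%E.
Proof.
move=> muT lamu.
have [|la' e'] := finite_measureP (mu := la).
  by apply: le_lt_trans muT; exact: lamu.
have [mu' e] := finite_measureP muT.
by have := @fin_diff mu' la'; rewrite e e'; exact.
Qed.

Lemma hahn_measures (mu la : {measure set T -> \bar R}) :
  (mu setT < +oo)%E -> (la setT < +oo)%E ->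
  exists P : set T, [/\ measurable P,
    forall A, measurable A -> A `<=` P -> (la A <= mu A)%E &
    forall A, measurable A -> A `<=` ~` P -> (mu A <= la A)%E].
Proof.
move=> /finite_measureP[mu' e] /finite_measureP[la' e'].
pose nu : {charge set T -> \bar R} :=
  cadd (charge_of_finite_measure mu') (copp (charge_of_finite_measure la')).
have nuE A : measurable A -> nu A = (mu A - la A)%E by rewrite -e -e'.
have lafin A : measurable A -> la A \is a fin_num.
  by move=> mA; rewrite -e' fin_num_measure.
have [P [N [[mP hP] [mN hN] PN PN0]]] := Hahn_decomposition nu.
exists P; split=> // A mA AP.
  by have := hP A mA AP; rewrite nuE// sube_ge0// lafin.
have AN : A `<=` N.
  move=> x Ax; have : (P `|` N) x by rewrite PN.
  by case=> // /(AP x Ax).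
by have := hN A mA AN; rewrite nuE// sube_le0// lafin.
Qed.

End MeasureDifference.

(** * Borel measurability for the pointwise topology *)

Section Measurability.
Variables (R : realType) (G : zmodType).
Local Notation X := (Gdelta R G).
Implicit Types (U K A : set X).

Lemma ptws_open_measurable U : ptws_open U -> measurable U.
Proof. by move=> oU; exact: sub_gen_smallest. Qed.

Lemma ptws_closed_measurable K : ptws_open (~` K) -> measurable K.
Proof. by move=> /ptws_open_measurable/measurableC; rewrite setCK. Qed.

Lemma ptws_compact_measurable K : ptws_compact K -> measurable K.
Proof. by move=> /ptws_compact_closed /ptws_closed_measurable. Qed.

(** [F] may jump across the boundary of [A]; the preimage of an open [U] is an open part inside [A]
    together with the trace of [U] on the complement. *)
Lemma measurable_cont_on A (F : X -> X) : ptws_open A -> ptws_cont_on A F ->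
  (forall x, ~ A x -> F x = x) -> measurable_fun setT F.
Proof.
move=> oA cF Fid.
apply: (@measurability _ _ _ _ setT F (@open_sets R G)) => // _ [U oU <-].
rewrite setTI.
have -> : F @^-1` U = (A `&` F @^-1` U) `|` (~` A `&` U).
  apply/seteqP; split=> x.
    have [Ax|nAx] := pselect (A x); first by left.
    by right; split=> //; rewrite -(Fid x).
  by move=> [[]//|[nAx Ux]] /=; rewrite Fid.
apply: measurableU.
  by apply: ptws_open_measurable; exact: ptws_open_preimage.
apply: measurableI; last exact: ptws_open_measurable.
by apply: measurableC; exact: ptws_open_measurable.
Qed.

Lemma measurable_charconj : measurable_fun setT (@charconj R G : X -> X).
Proof.
apply: (measurable_cont_on (@ptws_openT R G)); last by move=> x [].
exact: charconj_cont.
Qed.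

Lemma measurable_cont_real (f : X -> R) :
  (forall x, f @ ptws_nbhs x --> f x) -> measurable_fun setT f.
Proof.
move=> cf; apply: (measurability _ (RGenOpens.measurableE R)) => //.
move=> _ [_ [a [b ->]] <-]; rewrite setTI; apply: ptws_open_measurable.
by apply: ptws_open_real => //; exact: interval_open.
Qed.

End Measurability.

(** * Tightness and Radon measures *)

Section Tight.
Variables (R : realType) (G : zmodType).
Local Notation X := (Gdelta R G).
Local Open Scope ereal_scope.
Implicit Types (U K A : set X) (m : {measure set X -> \bar R}).

(** For finite measures this amounts to being Radon, and it passes readily to smaller measures, sums
    and images. *)
Definition tight (m : set X -> \bar R) := forall A, measurable A ->
  forall e : R, (0 < e)%R ->
  exists K, [/\ ptws_compact K, K `<=` A & m (A `\` K) < e%:E].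

(** From a compact [K0] of almost full mass, remove an open [U] that exceeds the complement of [A]
    only slightly; what is left is compact and inside [A]. *)
Lemma radon_tight m : m setT < +oo -> radon m -> tight m.
Proof.
move=> mT [_ outer inner] A mA e e0.
have mfin B : measurable B -> m B \is a fin_num by exact: lty_fin_num_fun.
have e2 : (0 < e / 2)%R by rewrite divr_gt0.
have mCA : measurable (~` A) by exact: measurableC.
have [U [oU AU] mU] : exists2 U, ptws_open U /\ ~` A `<=` U &
    m U < m (~` A) + (e / 2)%:E.
  have := outer _ mCA => /esym eI.
  have /lb_ereal_inf_adherent : ereal_inf [set m U | U in
      [set U | ptws_open U /\ ~` A `<=` U]] \is a fin_num by rewrite eI mfin.
  by move=> /(_ _ e2)[_ [U hU <-]]; rewrite eI; exists U.
have [K0 [cK0 _] mK0] : exists2 K, ptws_compact K /\ K `<=` setT &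
    m setT - (e / 2)%:E < m K.
  have := inner _ (@ptws_openT R G) => /esym eS.
  have /ub_ereal_sup_adherent : ereal_sup [set m K | K in
      [set K | ptws_compact K /\ K `<=` setT]] \is a fin_num by rewrite eS mfin.
  by move=> /(_ _ e2)[_ [K hK <-]]; rewrite eS; exists K.
have mUm := ptws_open_measurable oU.
have mKm := ptws_compact_measurable cK0.
exists (K0 `\` U); split; first exact: ptws_compactD.
  by move=> x [_ nUx]; apply: contrapT => /AU.
have sub : A `\` (K0 `\` U) `<=` (U `\` ~` A) `|` ~` K0.
  move=> x [Ax nx]; have [Kx|] := pselect (K0 x); last by right.
  left; split=> //.
  by apply: contrapT => nUx; apply: nx.
apply: (@le_lt_trans _ _ (m ((U `\` ~` A) `|` ~` K0))).
  apply: le_measure => //; rewrite inE; last first.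
    by apply: measurableU; [exact: measurableD|exact: measurableC].
  by apply: measurableD => //; exact: measurableD.
apply: (@le_lt_trans _ _ (m (U `\` ~` A) + m (~` K0))).
  by apply: measureU2; [exact: measurableD|exact: measurableC].
rewrite [e]splitr EFinD lteD//.
- rewrite measureD// ?ltey_eq ?mfin//.
  rewrite (_ : U `&` ~` A = ~` A); last by apply/setIidPr.
  by rewrite lteBlDl// mfin.
- rewrite -setTD measureD// ?ltey_eq ?mfin// setTI.
  by move: mK0; rewrite lteBlDr// => h; rewrite lteBlDr ?mfin// addeC.
Qed.

Lemma tight_radon m : m setT < +oo -> tight m -> radon m.
Proof.
move=> mT tm.
have mfin B : measurable B -> m B \is a fin_num by exact: lty_fin_num_fun.
split.
- by move=> K /ptws_compact_measurable mK; rewrite ltey_eq mfin.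
- move=> A mA; apply/eqP; rewrite eq_le; apply/andP; split.
    apply: le_ereal_inf_tmp => _ [U [oU AU] <-].
    by apply: le_measure => //; rewrite inE//; exact: ptws_open_measurable.
  apply/lee_addgt0Pr => e e0.
  (* The open superset of [A] is the complement of a compact subset of its complement. *)
  have [K [cK KA me]] := tm (~` A) (measurableC mA) e e0.
  have mK := ptws_compact_measurable cK.
  have AK : A `<=` ~` K by move=> x Ax /KA.
  apply: (@le_trans _ _ (m (~` K))).
    apply: ereal_inf_lbound; exists (~` K) => //; split=> //.
    exact: ptws_compact_closed.
  have -> : ~` K = A `|` (~` A `\` K).
    apply/seteqP; split=> x; last by move=> [/AK//|[]].
    by have [|] := pselect (A x); [left|right].
  rewrite (le_trans (measureU2 _ _ _))// ?leeD2l ?ltW//.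
  by apply: measurableD => //; exact: measurableC.
- move=> U oU; have mU := ptws_open_measurable oU.
  apply/eqP; rewrite eq_le; apply/andP; split; last first.
    apply: ge_ereal_sup => _ [K [cK KU] <-].
    by apply: le_measure => //; rewrite inE//; exact: ptws_compact_measurable.
  apply/lee_addgt0Pr => e e0.
  have [K [cK KU me]] := tm U mU e e0.
  have mK := ptws_compact_measurable cK.
  apply: (@le_trans _ _ (m (K `|` (U `\` K)))); first by rewrite setDUK.
  apply: le_trans (measureU2 _ _ _) _ => //; first exact: measurableD.
  by apply: leeD; [apply: ereal_sup_ubound; exists K|exact: ltW].
Qed.

Lemma tight_le m m' : (forall A, measurable A -> m A <= m' A) ->
  tight m' -> tight m.
Proof.
move=> mm' t A mA e e0; have [K [cK KA h]] := t A mA e e0.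
exists K; split=> //; apply: le_lt_trans h; apply: mm'.
by apply: measurableD => //; exact: ptws_compact_measurable.
Qed.

Lemma tight_add m m' : tight m -> tight m' -> tight (measure_add m m').
Proof.
move=> t t' A mA e e0.
have e2 : (0 < e / 2)%R by rewrite divr_gt0.
have [K [cK KA h]] := t A mA _ e2; have [K' [cK' KA' h']] := t' A mA _ e2.
have mK := ptws_compact_measurable cK; have mK' := ptws_compact_measurable cK'.
exists (K `|` K'); split; first exact: ptws_compactU.
  by move=> x [/KA|/KA'].
rewrite measure_addE [e]splitr EFinD.
have mAK : measurable (A `\` (K `|` K')).
  by apply: measurableD => //; exact: measurableU.
apply: lteD; [apply: le_lt_trans h|apply: le_lt_trans h'];
  by apply: le_measure; rewrite ?inE//; [exact: measurableD|
     move=> x [Ax nK]; split=> // Kx; apply: nK; by [left|right]].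
Qed.

(** A compact approximating the part of the preimage of [B] inside [A] has a compact image in [B];
    the part outside [A] is null. *)
Lemma tight_pushforward m A (F : X -> X) : ptws_open A -> ptws_cont_on A F ->
  measurable_fun setT F -> m (~` A) = 0 -> tight m -> tight (pushforward m F).
Proof.
move=> oA cF mF mA0 t B mB e e0.
have mA := ptws_open_measurable oA.
have mFB (C : set X) : measurable C -> measurable (F @^-1` C).
  by move=> mC; rewrite -[X in measurable X]setTI; exact: mF.
have mAB : measurable (A `&` F @^-1` B) by apply: measurableI => //; exact: mFB.
have [K [cK KA h]] := t _ mAB e e0.
have cFK : ptws_compact (F @` K).
  by apply: (ptws_compact_image oA cF) => // x /KA[].
exists (F @` K); split=> //; first by move=> _ [x /KA[_ FB] <-].
have mK := ptws_compact_measurable cK.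
rewrite /pushforward.
apply: (@le_lt_trans _ _ (m ((A `&` F @^-1` B) `\` K `|` ~` A))).
  apply: le_measure; rewrite ?inE.
  - by apply: mFB; apply: measurableD => //; exact: ptws_compact_measurable.
  - by apply: measurableU; [exact: measurableD|exact: measurableC].
  - move=> x [Bx nFK]; have [Ax|] := pselect (A x); last by right.
    by left; split=> // Kx; apply: nFK; exists x.
apply: (@le_lt_trans _ _ (m ((A `&` F @^-1` B) `\` K) + m (~` A))).
  by apply: measureU2; [exact: measurableD|exact: measurableC].
by rewrite mA0 adde0.
Qed.

End Tight.

(** * Representing measures and exchange of their parts *)

Section Representation.
Variables (R : realType) (G : zmodType).
Local Notation X := (Gdelta R G).
Local Open Scope ereal_scope.
Implicit Types (U K A B : set X) (m mu : {measure set X -> \bar R}).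
Implicit Types (g h : G) (phi : G -> quat R).

(** Numbering the coordinates lets one statement cover the four integrals; every index from 3 on
    gives the last coordinate. *)
Definition qcoord (i : nat) (q : quat R) : R :=
  match i with 0 => q0 q | 1 => q1 q | 2 => q2 q | _ => q3 q end.

Definition coordE g i (x : X) : \bar R := (qcoord i (chfun x g))%:E.

Lemma measurable_qcoord g i :
  measurable_fun setT (fun x : X => qcoord i (chfun x g)).
Proof.
apply: measurable_cont_real => x; have [c0 c1 c2 c3] := cvg_coord x g.
by case: i => [|[|[|i]]].
Qed.

Lemma integrable_coordE_comp m (F : X -> X) g i : m setT < +oo ->
  measurable_fun setT F -> m.-integrable setT (fun x => coordE g i (F x)).
Proof.
move=> mT mF.
apply: (@measurable_bounded_integrable _ _ _ m
  (fun x => qcoord i (chfun (F x) g))) => //.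
  by apply: (measurableT_comp (measurable_qcoord g i)).
exists 1%R; split; first exact: num_real.
move=> r r1 x _ /=; apply: le_trans (ltW r1).
by have [c0 c1 c2 c3] := coord_le1 (F x) g; case: i => [|[|[|i]]].
Qed.

Lemma integrable_coordE m g i : m setT < +oo -> m.-integrable setT (coordE g i).
Proof. by move=> mT; exact: (@integrable_coordE_comp m id). Qed.

Lemma representsP m phi : m setT < +oo ->
  represents m phi <->
  forall g i, qcoord i (phi g) = fine (\int[m]_x coordE g i x).
Proof.
move=> mT; split=> [r g i|e g].
  by have [_ _ _ _ ->] := r g; case: i => [|[|[|i]]].
have int i := integrable_coordE g i mT.
split; [exact: (int 0%N)|exact: (int 1%N)|exact: (int 2%N)|exact: (int 3%N)|].
have := e g 0%N; have := e g 1%N; have := e g 2%N; have := e g 3%N.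
by case: (phi g) => a b c d /= -> -> -> ->.
Qed.

(** The real part at [0] is constantly 1, so its integral is the total mass. *)
Lemma represents_finite m phi : represents m phi -> m setT < +oo.
Proof.
move=> /(_ 0%R)[i0 _ _ _ _].
rewrite -[m setT]mul1e -integral_cst//.
rewrite (eq_integral (fun x : X => (q0 (chfun x 0%R))%:E)); last first.
  by move=> x _; rewrite char0.
exact: integrable_lty i0.
Qed.

Lemma pushforward_measure m (F : X -> X) : measurable_fun setT F ->
  exists m' : {measure set X -> \bar R},
    m' = pushforward m F :> (set X -> \bar R).
Proof. by move=> mF; unshelve eexists (pushforward m F). Qed.

Lemma integral_push_coordE m (F : X -> X) g i : m setT < +oo ->
  measurable_fun setT F ->
  \int[pushforward m F]_x coordE g i x = \int[m]_x coordE g i (F x).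
Proof.
move=> mT mF.
have mc : measurable_fun setT (coordE g i).
  by apply/measurable_EFinP; exact: measurable_qcoord.
by rewrite integral_pushforward//; exact: integrable_coordE_comp.
Qed.

Definition determines mu phi := forall nu : {measure set X -> \bar R},
  radon nu -> represents nu phi -> forall A, measurable A -> nu A = mu A.

(* Replacing the part [la] of [mu] by [sg] yields another representing measure. *)
Lemma exchange_eq mu phi (la sg : {measure set X -> \bar R}) :
  radon mu -> represents mu phi -> determines mu phi ->
  (forall A, measurable A -> la A <= mu A) ->
  sg setT < +oo -> tight sg ->
  (forall g i, \int[la]_x coordE g i x = \int[sg]_x coordE g i x) ->
  forall A, measurable A -> la A = sg A.
Proof.
move=> rmu rep det lamu sgT tsg eqi A mA.
have muT := represents_finite rep.
have [rho murho] := measure_difference muT lamu.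
have rholemu B : measurable B -> rho B <= mu B.
  by move=> mB; rewrite murho// leeDl.
have rhoT : rho setT < +oo by exact: le_lt_trans (rholemu _ _) muT.
have laT : la setT < +oo by exact: le_lt_trans (lamu _ _) muT.
have mT : measure_add rho sg setT < +oo by rewrite measure_addE lte_add_pinfty.
have rm : radon (measure_add rho sg).
  apply: tight_radon => //; apply: tight_add => //.
  by apply: tight_le rholemu _; exact: radon_tight.
have repm : represents (measure_add rho sg) phi.
  apply/representsP => // g i.
  rewrite integral_measure_add//; [|exact: integrable_coordE..].
  rewrite -eqi -integral_measure_add//; [|exact: integrable_coordE..].
  rewrite (@eq_measure_integral _ _ _ _ mu).
    exact: (representsP phi muT).1 rep g i.
  by move=> B mB _; rewrite (murho B mB); exact: measure_addE.
have rhoA : rho A \is a fin_num.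
  rewrite ge0_fin_numE// (le_lt_trans (rholemu _ _))//.
  by apply: le_lt_trans muT; apply: le_measure; rewrite ?inE.
have e : rho A + sg A = rho A + la A.
  by rewrite -measure_addE -murho//; exact: det.
by rewrite -[LHS](addeK _ rhoA) -[RHS](addeK _ rhoA) ![_ + rho A]addeC e.
Qed.

(** [s] is the sum of the images of [k] under [F] and under [F] followed by conjugation. Imaginary
    coordinates cancel between the two and [F] keeps real parts, so the integrals do not depend on
    [F]. *)
Lemma symmetrization A (k : {measure set X -> \bar R}) (F : X -> X) :
  ptws_open A -> ptws_cont_on A F -> measurable_fun setT F ->
  (forall x h, q0 (chfun (F x) h) = q0 (chfun x h)) ->
  k (~` A) = 0 -> k setT < +oo -> tight k ->
  exists s : {measure set X -> \bar R},
  [/\ forall B, s B = k (F @^-1` B) + k (F @^-1` (@charconj R G @^-1` B)),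
      s setT < +oo, tight s &
      forall g i, \int[s]_x coordE g i x =
        if i is 0%N then \int[k]_x coordE g 0%N x + \int[k]_x coordE g 0%N x
        else 0].
Proof.
move=> oA cF mF qF kA kT tk.
have mcF : measurable_fun setT (@charconj R G \o F : X -> X).
  by apply: measurableT_comp => //; exact: measurable_charconj.
have [k1 e1] := pushforward_measure k mF.
have [k2 e2] := pushforward_measure k mcF.
have k1T : k1 setT < +oo by rewrite e1.
have k2T : k2 setT < +oo by rewrite e2.
exists (measure_add k1 k2); split.
- by move=> B; rewrite [LHS]measure_addE e1 e2.
- by rewrite [ltLHS]measure_addE lte_add_pinfty.
- apply: tight_add.
    by rewrite e1; exact: tight_pushforward cF _ kA tk.
  rewrite e2; apply: (@tight_pushforward _ _ k A) => //.
  move=> x Ax U hU.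
  exact: (cF x Ax _ (@charconj_cont R G setT (F x) I U hU)).
- move=> g i.
  rewrite integral_measure_add//; [|exact: integrable_coordE..].
  have -> : \int[k1]_x coordE g i x = \int[k]_x coordE g i (F x).
    by rewrite e1; exact: integral_push_coordE.
  have -> : \int[k2]_x coordE g i x = \int[k]_x coordE g i (charconj (F x)).
    by rewrite e2; exact: integral_push_coordE kT mcF.
  case: i => [|i].
    by congr (_ + _); apply: eq_integral => x _; rewrite /coordE /= qF.
  have ki := integrable_coordE_comp g i.+1 kT mF.
  rewrite [X in _ + X](eq_integral (fun x => - coordE g i.+1 (F x))).
    by rewrite integralN ?integrable_add_def// subee// integrable_fin_num.
  by move=> x _; rewrite /coordE -EFinN; case: i {ki} => [|[|i]].
Qed.

End Representation.

(** * Nullity of the symmetric part off the real characters *)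

Section Singularity.
Variables (R : realType) (G : zmodType).
Local Notation X := (Gdelta R G).
Local Open Scope ereal_scope.
Implicit Types (U K A B : set X) (m mu nu k : {measure set X -> \bar R}).
Implicit Types (g h : G) (phi : G -> quat R).

Lemma measurable_nonreal g : measurable (nonreal g : set X).
Proof. by apply: ptws_open_measurable; exact: nonreal_open. Qed.

Lemma measurable_align w (w1 : imdot w w = 1%R) g :
  measurable_fun setT (align w1 g : X -> X).
Proof.
apply: (measurable_cont_on (@nonreal_open R G g)); first exact: align_cont.
by move=> x; exact: align_real.
Qed.

Lemma q0_align w (w1 : imdot w w = 1%R) g (x : X) h :
  q0 (chfun (align w1 g x) h) = q0 (chfun x h).
Proof.
have [xg|xg] := pselect (nonreal g x); first by rewrite alignE.
by rewrite align_real.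
Qed.

Lemma measurable_preim_charconj A : measurable A ->
  measurable (@charconj R G @^-1` A : set X).
Proof.
by move=> mA; rewrite -[X in measurable X]setTI; exact: measurable_charconj.
Qed.

(* The symmetrization of [k] has the same integrals as its symmetrized images on
   the characters with [x g] in the plane of [i] and in the plane of [j];
   these two sets of characters are disjoint. *)
Lemma symmetric_part_null mu phi k g :
  radon mu -> represents mu phi -> determines mu phi ->
  (forall A, measurable A -> k A + k (@charconj R G @^-1` A) <= mu A) ->
  k (~` nonreal g) = 0 -> k (nonreal g) = 0.
Proof.
move=> rmu rep det kmu kg.
have muT := represents_finite rep.
have kle A : measurable A -> k A <= mu A.
  by move=> mA; apply: le_trans (kmu A mA); rewrite leeDl.
have kT : k setT < +oo by exact: le_lt_trans (kle _ _) muT.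
have tk : tight k by apply: tight_le kle _; exact: radon_tight.
have oA := @nonreal_open R G g.
(* The symmetrization of [k] itself, with [F = id]. *)
have [la [laE _ _ lai]] : exists s : {measure set X -> \bar R},
    [/\ forall B, s B = k B + k (@charconj R G @^-1` B),
      s setT < +oo, tight s &
      forall h i, \int[s]_x coordE h i x =
        if i is 0%N then \int[k]_x coordE h 0%N x + \int[k]_x coordE h 0%N x
        else 0].
  by apply: (@symmetrization _ _ (nonreal g) k id) => //; exact: measurable_id.
have laleB B : measurable B -> la B <= mu B by move=> mB; rewrite laE kmu.
(* For every imaginary unit [w], the exchange shows that [la] equals the symmetrized image of [k] in
   the plane of [w]. *)
have al w (w1 : imdot w w = 1%R) B : measurable B ->
    la B = k (align w1 g @^-1` B) +
           k (align w1 g @^-1` (@charconj R G @^-1` B)).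
  move=> mB.
  have [s [sE sT ts si]] := symmetrization oA (@align_cont R G w w1 g)
    (measurable_align w1 g) (q0_align w1 g) kg kT tk.
  rewrite -sE; apply: (exchange_eq rmu rep det) => //.
  by move=> h i; rewrite lai si.
pose wi : quat R := Quat 0 1 0 0; pose wj : quat R := Quat 0 0 1 0.
have wi1 : imdot wi wi = 1%R by rewrite /imdot /=; ring.
have wj1 : imdot wj wj = 1%R by rewrite /imdot /=; ring.
(* For [x] with [x g] non-real, [B] contains the image in the plane of [i] and misses the one in the
   plane of [j]; conjugation preserves both facts. *)
pose B : set X := [set x | q1 (chfun x g) != 0%R].
have mB : measurable B.
  apply: ptws_open_measurable.
  apply: (@ptws_open_real R G (fun x => q1 (chfun x g)) [set r | r != 0%R]).
    by move=> x; case: (cvg_coord x g).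
  exact: open_neq.
have mpre (F : X -> X) A : measurable_fun setT F -> measurable A ->
    measurable (F @^-1` A).
  by move=> mF mA; rewrite -[X in measurable X]setTI; exact: mF.
have mcB := measurable_preim_charconj mB.
have mg := measurable_nonreal g.
have null A : measurable A -> A `<=` ~` nonreal g -> k A = 0.
  move=> mA Ag; apply/eqP; rewrite eq_le measure_ge0 andbT -kg.
  by apply: le_measure; rewrite ?inE//; exact: measurableC.
(* Seen in the plane of [j], [la] does not charge [B]. *)
have laB : la B = 0.
  rewrite (al _ wj1 _ mB) !null ?adde0//.
  - exact: mpre (measurable_align _ _) mcB.
  - move=> x; rewrite /B /= => + xg; have [-> _ _] := align_im wj1 xg.
    by rewrite mulr0 oppr0 eqxx.
  - exact: mpre (measurable_align _ _) mB.
  - move=> x; rewrite /B /= => + xg; have [-> _ _] := align_im wj1 xg.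
    by rewrite mulr0 eqxx.
(* Seen in the plane of [i], [la] is carried by [B]. *)
have laCB : la (~` B) = 0.
  rewrite (al _ wi1 _ (measurableC mB)) !null ?adde0//.
  - apply: mpre (measurable_align _ _) _.
    exact: measurable_preim_charconj (measurableC mB).
  - move=> x; rewrite /B /= => + xg; have [-> _ _] := align_im wi1 xg.
    by apply; rewrite mulr1 oppr_eq0 gt_eqF// sqrtr_gt0; exact/nonrealP.
  - exact: mpre (measurable_align _ _) (measurableC mB).
  - move=> x; rewrite /B /= => + xg; have [-> _ _] := align_im wi1 xg.
    by apply; rewrite mulr1 gt_eqF// sqrtr_gt0; exact/nonrealP.
have laT : la setT = 0.
  apply/eqP; rewrite eq_le measure_ge0 andbT -(setUv B).
  have mCB := measurableC mB.
  apply: (@le_trans _ _ (la B + la (~` B))); first exact: measureU2.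
  by rewrite laB laCB adde0.
apply/eqP; rewrite eq_le measure_ge0 andbT -laT laE preimage_setT.
apply: le_trans (leeDl _ (measure_ge0 k _)).
by apply: le_measure; rewrite ?inE.
Qed.

(** The union over [g] may be uncountable, but each compact subset of it is covered by finitely many
    of the null sets, and tightness passes from compact subsets to the whole. *)
Lemma tight_null_nonreal nu : tight nu -> (forall g, nu (nonreal g) = 0) ->
  nu (~` @Gdelta_R R G) = 0.
Proof.
move=> t nug.
have CE : ~` @Gdelta_R R G = [set x | exists g, nonreal g x].
  apply/seteqP; split=> x /=; last by move=> [g xg] /(_ g).
  by move=> /existsNP.
have mC : measurable (~` @Gdelta_R R G).
  rewrite CE; apply: ptws_open_measurable; apply: ptws_open_bigcup => g.
  exact: nonreal_open.
pose D (s : seq G) : set X := [set x | exists2 g, g \in s & nonreal g x].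
have D0 s : measurable (D s) /\ nu (D s) = 0.
  elim: s => [|g s [mD ih]].
    have -> : D [::] = set0 by rewrite -subset0 => x [].
    by rewrite measure0.
  have -> : D (g :: s) = nonreal g `|` D s.
    apply/seteqP; split=> x.
      by move=> [h]; rewrite inE => /orP[/eqP->|hs] xh; [left|right; exists h].
    move=> [xg|[h hs xh]]; [exists g|exists h] => //; rewrite inE ?eqxx//.
    by rewrite hs orbT.
  have mg := measurable_nonreal g.
  split; first exact: measurableU.
  apply/eqP; rewrite eq_le measure_ge0 andbT.
  apply: (@le_trans _ _ (nu (nonreal g) + nu (D s))); first exact: measureU2.
  by rewrite nug ih adde0.
apply/eqP; rewrite eq_le measure_ge0 andbT.
apply/lee_addgt0Pr => e e0; rewrite add0e.
have [K [cK KC h]] := t _ mC e e0.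
have [x /KC|n [f Kf]] := cK G (fun g => nonreal g) (@nonreal_open R G).
  by rewrite CE.
have mK := ptws_compact_measurable cK.
have [mD nD] := D0 [seq f j | j <- enum 'I_n].
have K0 : nu K <= 0.
  rewrite -nD; apply: le_measure; rewrite ?inE// => x /Kf[j xj].
  by exists (f j) => //; apply: map_f; rewrite mem_enum.
apply: (@le_trans _ _ (nu (K `|` (~` @Gdelta_R R G `\` K)))).
  by rewrite setDUK.
apply: le_trans (measureU2 _ mK _) _; first exact: measurableD.
by rewrite -[e%:E]add0e; apply: leeD => //; exact: ltW.
Qed.

(** Conjugation is an involution, so images and preimages agree. *)
Lemma conjsetE A : conjset A = @charconj R G @^-1` A.
Proof.
apply/seteqP; split=> x /=.
  move=> [y Ay e]; suff -> : charconj x = y by [].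
  by rewrite -[RHS]charconjK; congr charconj; exact: char_eqP.
move=> Ax; exists (charconj x) => // g /=; case: (chfun x g) => ? ? ? ?.
by rewrite /qconj /= !opprK.
Qed.

End Singularity.

(** * Singularity of the measure and its conjugate on a Hahn set *)

Theorem mainTheorem15 (R : realType) (G : zmodType) (phi : G -> quat R)
  (mu : {measure set (Gdelta R G) -> \bar R}) :
  PstarH phi ->
  radon mu -> represents mu phi ->
  (forall nu : {measure set (Gdelta R G) -> \bar R},
      radon nu -> represents nu phi -> forall A, measurable A -> nu A = mu A) ->
  mutually_singular (restr (pushconj mu) (~` @Gdelta_R R G))
                    (restr mu (~` @Gdelta_R R G)).
Proof.
move=> _ rmu rep det.
have muT := represents_finite rep.
have [mus musE] := pushforward_measure mu (@measurable_charconj R G).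
have musT : (mus setT < +oo)%E by rewrite musE.
have [P [mP leP leN]] := hahn_measures muT musT.
have mN := measurableC mP.
(* On each side of the Hahn decomposition [nu] takes the smaller of the two measures: [mus] on [P],
   [mu] off [P]. *)
pose nu : {measure set (Gdelta R G) -> \bar R} :=
    measure_add (mrestr mus mP) (mrestr mu mN).
have nuE A : nu A = (mus (A `&` P) + mu (A `&` ~` P))%E by exact: measure_addE.
have split_P (m : {measure set (Gdelta R G) -> \bar R}) A : measurable A ->
    m A = (m (A `&` P) + m (A `&` ~` P))%E.
  by move=> mA; rewrite (measureDI m mA mP) setDE addeC.
have nu_mu A : measurable A -> (nu A <= mu A)%E.
  move=> mA; rewrite nuE (split_P mu A mA); apply: leeD => //; apply: leP.
    exact: measurableI.
  by move=> x [].
have nu_mus A : measurable A -> (nu A <= mus A)%E.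
  move=> mA; rewrite nuE (split_P mus A mA); apply: leeD => //; apply: leN.
    exact: measurableI.
  by move=> x [].
have nug g : nu (nonreal g) = 0%E.
  have mg := @measurable_nonreal R G g.
  have half_ge0 : 0 <= (2 : R)^-1 by rewrite invr_ge0.
  (* The factor 1/2 makes room for both [k] and its conjugate below [mu]. *)
  pose k : {measure set (Gdelta R G) -> \bar R} :=
    mscale (NngNum half_ge0) (mrestr nu mg).
  have kE (A : set (Gdelta R G)) :
    k A = (((2 : R)^-1)%:E * nu (A `&` nonreal g))%E by [].
  have : k (nonreal g) = 0%E.
    apply: (symmetric_part_null rmu rep det); last first.
      by rewrite kE setICl measure0 mule0.
    move=> A mA.
    have mcA := measurable_preim_charconj mA.
    have half B : measurable B -> (k B <= ((2 : R)^-1)%:E * nu B)%E.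
      move=> mB; rewrite kE lee_pmul2l ?lte_fin//.
      exact: measureIl.
    apply: (@le_trans _ _ (((2 : R)^-1)%:E * mu A +
        ((2 : R)^-1)%:E * mu A)%E); last first.
      rewrite -ge0_muleDl ?lee_fin// -EFinD.
      have -> : (2^-1 + 2^-1 = 1 :> R) by lra.
      by rewrite mul1e.
    apply: leeD; apply: le_trans (half _ _) _ => //.
      by rewrite lee_pmul2l ?lte_fin// nu_mu.
    (* For the conjugate half, [nu] is bounded by [mus], whose value on the conjugate of [A] is
       [mu A]. *)
    rewrite lee_pmul2l ?lte_fin//; apply: le_trans (nu_mus _ mcA) _.
    rewrite musE /pushforward -comp_preimage.
    have -> : @charconj R G \o @charconj R G = id.
      by apply/funext => x; exact: charconjK.
    by rewrite preimage_id.
  rewrite kE setIid => /eqP; rewrite mule_eq0 eqe invr_eq0 pnatr_eq0 /=.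
  by move/eqP.
have nut : tight nu by apply: tight_le nu_mu _; exact: radon_tight.
(* Off the real characters both summands of [nu] vanish: [mus] is null on [P] and [mu] on its
   complement, so [P] is the required set. *)
have := tight_null_nonreal nut nug; rewrite nuE => /eqP.
rewrite padde_eq0 ?measure_ge0// => /andP[/eqP h1 /eqP h2].
exists P; split=> //.
- by rewrite /restr /pushconj conjsetE [P `&` _]setIC; move: h1; rewrite musE.
- by rewrite /restr setIC.
Qed.
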